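(* Let $\mathrm{Pal}(x)$ be the palinomial induced by a 1089 $(n,b)$-palintiple $(d_k,d_{k-1},\ldots,d_0)_b$, and let $D$ and $\overline{D}$ denote its digit and reverse-digit polynomials, respectively. Then $$D(x)=(d_kx^2-x+d_0)\,\frac{\mathrm{Pal}(x)}{(n-1)(x-b)}\quad\text{and}\quad \overline{D}(x)=(d_0x^2-x+d_k)\,\frac{\mathrm{Pal}(x)}{(n-1)(x-b)}.$$
   Context: For integers $1<n<b$ and $k\ge 1$, write $(d_k,\ldots,d_0)_b=\sum_{j=0}^k d_jb^j$ with digits $0\le d_j<b$. It is called a $(k+1)$-digit $(n,b)$-palintiple (with multiplier $n$ and base $b$) if $d_k\neq 0$ (no leading zeros) and $(d_k,d_{k-1},\ldots,d_0)_b=n\,(d_0,d_1,\ldots,d_k)_b$. A 1089 $(n,b)$-palintiple is an $(n,b)$-palintiple whose Young graph $Y(n,b)$ is isomorphic to $Y(9,10)$; by a theorem of Kendrick this is equivalent to the condition that $n+1$ divides $b$, which may be taken as the definition here. The palinomial induced by an $(n,b)$-palintiple $(d_k,\ldots,d_0)_b$ is $\mathrm{Pal}(x)=\sum_{j=0}^k(d_j-nd_{k-j})x^j$; it is divisible by $x-b$. The digit polynomial is $D(x)=\sum_{j=0}^k d_jx^j$ and the reverse-digit polynomial is $\overline{D}(x)=\sum_{j=0}^k d_{k-j}x^j$. *)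

(* Defs.v *)
(* MathComp world. *)
From mathcomp Require Import all_boot all_order all_algebra.

Set Implicit Arguments.
Unset Strict Implicit.
Unset Printing Implicit Defensive.

Import Order.TTheory GRing.Theory Num.Theory.

Local Open Scope ring_scope.

(* A string of k + 1 digits (d_k, ..., d_0) is a map d : 'I_k.+1 -> nat, where
   d j is the coefficient of b ^ j.  Thus d ord0 = d_0 is the least significant
   digit and d ord_max = d_k the leading one. *)

Definition rev_digits (k : nat) (d : 'I_k.+1 -> nat) : 'I_k.+1 -> nat :=
  fun j => d (rev_ord j).

Definition digits_value (b k : nat) (d : 'I_k.+1 -> nat) : nat :=
  (\sum_(j < k.+1) d j * b ^ j)%N.

Definition palintiple (n b k : nat) (d : 'I_k.+1 -> nat) : Prop :=
  [/\ forall j : 'I_k.+1, (d j < b)%N,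
      d ord_max <> 0%N
    & digits_value b d = (n * digits_value b (rev_digits d))%N].

(* The 1089 class is the one whose Young graph is isomorphic to Y(9,10); by a
   theorem of Kendrick this depends only on (n, b) and means that n + 1 divides
   b, which is taken as the definition. *)
Definition palintiple_1089 (n b k : nat) (d : 'I_k.+1 -> nat) : Prop :=
  palintiple n b d /\ (n.+1 %| b)%N.

Definition digit_poly (k : nat) (d : 'I_k.+1 -> nat) : {poly rat} :=
  \sum_(j < k.+1) (d j)%:R *: 'X^j.

Definition rev_digit_poly (k : nat) (d : 'I_k.+1 -> nat) : {poly rat} :=
  \sum_(j < k.+1) (d (rev_ord j))%:R *: 'X^j.

Definition palinomial (n k : nat) (d : 'I_k.+1 -> nat) : {poly rat} :=
  \sum_(j < k.+1) ((d j)%:R - n%:R * (d (rev_ord j))%:R) *: 'X^j.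

(* Euclidean division of the palinomial by a nonzero multiple of 'X - b is
   exact. *)
Lemma palinomial_dvd (n b k : nat) (d : 'I_k.+1 -> nat) :
  palintiple n b d -> 'X - (b%:R)%:P %| palinomial n d.
Proof.
case=> _ _ hv; rewrite dvdp_XsubCl; apply/rootP.
have ev (e : 'I_k.+1 -> nat) :
  (digits_value b e)%:R = \sum_(j < k.+1) (e j)%:R * b%:R ^+ j :> rat.
  by rewrite natr_sum; apply: eq_bigr => j _; rewrite natrM natrX.
rewrite horner_sum.
under eq_bigr => j _ do rewrite hornerZ hornerXn mulrBl -mulrA.
by rewrite sumrB -mulr_sumr -ev -(ev (rev_digits d)) hv natrM subrr.
Qed.

(* Main.v *)
Require Import Defs.
From mathcomp Require Import all_boot all_order all_algebra.
From mathcomp Require Import ring zify.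

Set Implicit Arguments.
Unset Strict Implicit.
Unset Printing Implicit Defensive.

Import Order.TTheory GRing.Theory Num.Theory.

Local Open Scope ring_scope.

(** Let [D] be the digit polynomial of the palintiple, [R] its reversal, both
    with integer coefficients.  Since [b] is a root of [D - n R], the factor
    theorem gives [D - n R = C * ('X - b)] over the integers.  The polynomial
    [C * 'X] lists the carries [c_j] of the multiplication by [n], because
    comparing coefficients gives [n r_j + c_j = d_j + b c_(j+1)] with
    [c_0 = 0]; in particular [0 <= c_j < n] ([carry_bounds]).

    Assume now that [b = (n + 1) q].  Modulo [n + 1] the carry equation reads
    [c_j = d_j + r_j], which is symmetric under digit reversal, so the bounds
    force [c_(k-j) = c_j] ([carry_palindromic]).  Solving the carry equations
    at [j] and [k - j] for the two digits they share then yields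
    [(n - 1) D = (n q 'X^2 - 'X + q) C] ([digit_carry_identity]).  The quadratic
    factor has a coefficient -1, so it is primitive, and by Gauss's lemma
    [n - 1] divides the content of [C] ([dvdz_coef_primitiveM]).  Comparing
    outer coefficients gives [d_k = n d_0] and [(n - 1) d_0 = q c_1], so that
    [c_1 <> 0] as the leading digit is nonzero; being less than [n], it is
    [n - 1], whence [d_0 = q] and [d_k = n q] ([outer_digits_1089]).
    The identity for [(n - 1) D] is then the first formula with the division
    by [(n - 1)('X - b)] cleared, since the palinomial is [C * ('X - b)]; the
    second follows from it by substituting [n R = D - C * ('X - b)]. *)

(** * Carries of a multiplication *)

(** One step of the schoolbook multiplication: an incoming carry from [0] to
    [n - 1] makes [b c_(j+1)] larger than [- b] and smaller than [n b]. *)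
Lemma carry_bounds (n b : int) (d r c : nat -> int) :
    0 < n -> (forall j, 0 <= d j < b) -> (forall j, 0 <= r j < b) ->
    c 0%N = 0 -> (forall j, d j - n * r j = c j - b * c j.+1) ->
  forall j, 0 <= c j < n.
Proof.
move=> n_gt0 d_digit r_digit c0 cS; elim=> [|j IHj]; first by rewrite c0; lia.
have := cS j; have := d_digit j; have := r_digit j.
by move=> /andP[? ?] /andP[? ?] cSj; case/andP: IHj => ? ?; apply/andP; nia.
Qed.

(** Both [c j] and [c (k - j)] are congruent to [d j + r j] modulo [n + 1],
    and two carries differ by less than [n]. *)
Lemma carry_palindromic (n q : int) (k : nat) (d r c : nat -> int) :
    (forall j, (j <= k)%N -> r j = d (k - j)%N) ->
    (forall j, 0 <= c j < n) ->
    (forall j, d j - n * r j = c j - (n + 1) * q * c j.+1) ->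
  forall j, (j <= k)%N -> c (k - j)%N = c j.
Proof.
move=> rE c_bound cS j le_jk.
have := cS j; have := cS (k - j)%N; rewrite (rE j) // (rE (k - j)%N) ?leq_subr //.
rewrite subKn // => cSkj cSj.
have /andP[? ?] := c_bound j; have /andP[? ?] := c_bound (k - j)%N.
set t := d j - d (k - j)%N + q * (c j.+1 - c (k - j).+1).
have dc : c j - c (k - j)%N = (n + 1) * t by rewrite /t; lia.
have t0 : t = 0 by nia.
by move: dc; rewrite t0; lia.
Qed.

(** * Polynomial form of the carry equations *)

Lemma carry_equation (n b : int) (D R C : {poly int}) :
    D - n *: R = C * ('X - b%:P) ->
  forall j, D`_j - n * R`_j = (C * 'X)`_j - b * (C * 'X)`_j.+1.
Proof.
move=> DRC j; have /(congr1 (fun p : {poly int} => p`_j)) := DRC.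
by rewrite coefB coefZ mulrBr coefB coefMC !coefMX /= => ->; rewrite [b * _]mulrC.
Qed.

(** There is no carry out of the leading digit, by comparison of degrees. *)
Lemma size_carry (n b : int) (k : nat) (D R C : {poly int}) :
    (size D <= k.+1)%N -> (size R <= k.+1)%N ->
    D - n *: R = C * ('X - b%:P) ->
  (size C <= k)%N.
Proof.
move=> sD sR DRC; have [->|C_neq0] := eqVneq C 0; first by rewrite size_poly0.
have : (size (C * ('X - b%:P))%R <= k.+1)%N.
  rewrite -DRC (leq_trans (size_polyD _ _)) // size_polyN geq_max sD.
  exact: leq_trans (size_scale_leq _ _) sR.
by rewrite size_Mmonic ?monicXsubC // size_XsubC addn2.
Qed.

Lemma reversal_carries (n q : int) (k : nat) (D C : {poly int}) :
    let R := \poly_(j < k.+1) D`_(k - j) in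
    0 < n -> (forall j, 0 <= D`_j < (n + 1) * q) ->
    D - n *: R = C * ('X - ((n + 1) * q)%:P) ->
  (forall j, 0 <= (C * 'X)`_j < n)
  /\ (forall j, (j <= k)%N -> (C * 'X)`_(k - j) = (C * 'X)`_j).
Proof.
move=> R n_gt0 D_digit DRC.
have R_digit j : 0 <= R`_j < (n + 1) * q.
  rewrite coef_poly; case: ifP => // _.
  by have /andP[? ?] := D_digit 0%N; apply/andP; lia.
have RE j : (j <= k)%N -> R`_j = D`_(k - j) by rewrite coef_poly ltnS => ->.
have cS := carry_equation DRC.
have c0 : (C * 'X)`_0 = 0 by rewrite coefMX.
have c_bound := carry_bounds n_gt0 D_digit R_digit c0 cS.
split=> // j.
by apply: (@carry_palindromic n q k (nth 0 D) (nth 0 R) (nth 0 (C * 'X))).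
Qed.

(** Eliminating [R`_j] between the carry equations at [j] and [k - j] gives
    [(n^2 - 1) D`_j] in terms of carries; the symmetry of the carries turns
    the one of index [k - j + 1] into the one of index [j - 1], and the common
    factor [n + 1] cancels. *)
Lemma digit_carry_identity (n q : int) (k : nat) (D C : {poly int}) :
    let R := \poly_(j < k.+1) D`_(k - j) in
    0 < n -> (size D <= k.+1)%N -> (forall j, 0 <= D`_j < (n + 1) * q) ->
    D - n *: R = C * ('X - ((n + 1) * q)%:P) ->
  (n - 1) *: D = ((n * q) *: 'X^2 - 'X + q%:P) * C.
Proof.
move=> R n_gt0 sD D_digit DRC.
have RE j : (j <= k)%N -> R`_j = D`_(k - j) by rewrite coef_poly ltnS => ->.
have sC := size_carry sD (size_poly _ _) DRC.
have cS := carry_equation DRC.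
have c0 : (C * 'X)`_0 = 0 by rewrite coefMX.
have [_ csym] := reversal_carries n_gt0 D_digit DRC.
have ck : (C * 'X)`_k = 0 by have := csym 0%N (leq0n k); rewrite subn0 c0.
apply/polyP=> j.
have -> : (((n * q) *: 'X^2 - 'X + q%:P) * C)`_j =
    n * q * (C * 'X * 'X)`_j - (C * 'X)`_j + q * (C * 'X)`_j.+1.
  rewrite mulrDl mulrBl coefD coefB coefCM -scalerAl coefZ ['X * C]mulrC.
  by rewrite ['X^2 * C]mulrC expr2 mulrA [(C * 'X)`_j.+1]coefMX.
rewrite coefZ; have [le_jk|lt_kj] := leqP j k; last first.
  (* The term in [j - 1] vanishes even for [j = k + 1], where it is the carry
     into position [k], equal to [c_0 = 0] by symmetry. *)
  have nC i : (k <= i)%N -> (C * 'X)`_i = 0.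
    rewrite leq_eqVlt => /predU1P[<- //|lt_ki]; rewrite coefMX.
    by case: i lt_ki => // i lt_ki; rewrite nth_default //= (leq_trans sC).
  have -> : (C * 'X * 'X)`_j = 0.
    by rewrite coefMX; case: j lt_kj => // j; rewrite ltnS => /nC.
  by rewrite !nC ?leqW ?(ltnW lt_kj) // nth_default ?(leq_trans sD) //; ring.
have c_pred : (C * 'X)`_(k - j).+1 = (C * 'X * 'X)`_j.
  rewrite [RHS]coefMX; case: j le_jk => [|j] lt_jk.
    by rewrite subn0 coefMX /= nth_default.
  by rewrite subnSK //= csym // ltnW.
have := cS j; have := cS (k - j)%N.
rewrite (RE j) // (RE (k - j)%N) ?leq_subr // subKn // csym // c_pred.
move: D`_j D`_(k - j) (C * 'X)`_j (C * 'X)`_j.+1 (C * 'X * 'X)`_j.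
move=> x y c c1 c2 ey ex.
apply: (@mulfI _ (n + 1)); first by apply/eqP; lia.
have : n * (y - n * x) + (x - n * y) =
    n * (c - (n + 1) * q * c2) + (c - (n + 1) * q * c1) by rewrite ey ex.
by move=> e; nia.
Qed.

(** Gauss's lemma: contents are multiplicative, and that of [P] is a unit since
    it divides a coefficient -1. *)
Lemma dvdz_coef_primitiveM (m : int) (i : nat) (P C D : {poly int}) :
    P`_i = -1 -> m *: D = P * C ->
  forall j, (m %| C`_j)%Z.
Proof.
move=> Pi mD j.
have contC (p : {poly int}) l : (zcontents p %| p`_l)%Z.
  by have := dvdzz (zcontents p); rewrite dvdz_contents => /polyOverP.
apply: dvdz_trans (contC C j).
have : (m %| zcontents (P * C))%Z by rewrite -mD zcontentsZ dvdz_mulr.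
have := contC P i; rewrite Pi zcontentsM => /dvdzP[u uP] mPC.
have -> : zcontents C = - u * (zcontents P * zcontents C).
  by rewrite mulrA mulNr -uP opprK mul1r.
exact: dvdz_mull.
Qed.

(** * The 1089 identity with integer coefficients *)

(** The first carry [C`_0] is a nonzero multiple of [n - 1] below [n], which pins
    down the two outer digits. *)
Lemma outer_digits_1089 (n q : int) (k : nat) (D C : {poly int}) :
    let R := \poly_(j < k.+1) D`_(k - j) in
    1 < n -> (size D <= k.+1)%N -> (forall j, 0 <= D`_j < (n + 1) * q) ->
    D`_k != 0 ->
    D - n *: R = C * ('X - ((n + 1) * q)%:P) ->
  D`_0 = q /\ D`_k = n * q.
Proof.
move=> R n_gt1 sD D_digit Dk_neq0 DRC.
have n_gt0 : 0 < n by lia.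
have DC := digit_carry_identity n_gt0 sD D_digit DRC.
have sC := size_carry sD (size_poly _ _) DRC.
have cS := carry_equation DRC.
have c0 : (C * 'X)`_0 = 0 by rewrite coefMX.
have [c_bound csym] := reversal_carries n_gt0 D_digit DRC.
have C0_bound := c_bound 1%N; rewrite coefMX /= in C0_bound.
have P1 : ((n * q) *: 'X^2 - 'X + q%:P : {poly int})`_1 = -1.
  by rewrite coefD coefB coefZ coefXn coefX coefC /= mulr0 sub0r addr0.
have /dvdzP[u C0E] := dvdz_coef_primitiveM P1 DC 0%N.
have D0E : (n - 1) * D`_0 = q * C`_0.
  rewrite -coefZ DC mulrDl mulrBl coefD coefB coefCM -scalerAl coefZ.
  by rewrite ['X^2 * C]mulrC ['X * C]mulrC coefMXn coefMX /= mulr0 !subr0 add0r.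
have DkE : D`_k = n * D`_0.
  have ck : (C * 'X)`_k = 0.
    by have := csym 0%N (leq0n k); rewrite subn0 c0.
  have := cS k; rewrite ck coefMX /= [C`_k]nth_default // coef_poly ltnSn subnn.
  by rewrite mulr0 subr0 => /subr0_eq.
have /andP[C0_ge0 C0_lt] := C0_bound.
have C0_neq0 : C`_0 != 0.
  by apply: contraNneq Dk_neq0 => C00; rewrite DkE; apply/eqP; nia.
have u1 : u = 1 by rewrite C0E in C0_ge0 C0_lt C0_neq0; nia.
have D0q : D`_0 = q.
  by apply: (@mulfI _ (n - 1)); [apply/eqP | rewrite D0E C0E u1]; lia.
by rewrite DkE D0q.
Qed.

(** The reversed formula needs no second elimination: substituting the first
    one into [n R = D - C * ('X - b)] leaves [n (q 'X^2 - 'X + n q) C]. *)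
Lemma digit_poly_1089_int (n q : int) (k : nat) (D C : {poly int}) :
    let R := \poly_(j < k.+1) D`_(k - j) in
    1 < n -> (size D <= k.+1)%N -> (forall j, 0 <= D`_j < (n + 1) * q) ->
    D`_k != 0 ->
    D - n *: R = C * ('X - ((n + 1) * q)%:P) ->
  (n - 1) *: D = (D`_k *: 'X^2 - 'X + (D`_0)%:P) * C
  /\ (n - 1) *: R = (D`_0 *: 'X^2 - 'X + (D`_k)%:P) * C.
Proof.
move=> R n_gt1 sD D_digit Dk_neq0 DRC.
have n_gt0 : 0 < n by lia.
have DC := digit_carry_identity n_gt0 sD D_digit DRC.
have [-> ->] := outer_digits_1089 n_gt1 sD D_digit Dk_neq0 DRC.
split=> //; apply: (@mulfI _ n%:P); first by rewrite polyC_eq0; apply/eqP; lia.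
have nR : n *: R = D - C * ('X - ((n + 1) * q)%:P) by rewrite -DRC; ring.
rewrite mul_polyC scalerA mulrC -scalerA nR scalerBr DC -!mul_polyC.
by rewrite !(rmorphM, rmorphD, rmorphB, rmorph1) /=; ring.
Qed.

(** * Transfer to rational polynomials *)

(** The natural number digits read as an integer polynomial, which is where
    the factor theorem and Gauss's lemma apply. *)
Definition int_digit_poly (k : nat) (d : 'I_k.+1 -> nat) : {poly int} :=
  \poly_(j < k.+1) (d (inord j))%:Z.

Lemma map_int_digit_poly k (d : 'I_k.+1 -> nat) :
  map_poly intr (int_digit_poly d) = digit_poly d.
Proof.
rewrite /int_digit_poly poly_def raddf_sum; apply: eq_bigr => j _.
by rewrite /= map_polyZ map_polyXn inord_val.
Qed.

Lemma int_digit_poly_rev k (d : 'I_k.+1 -> nat) :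
  int_digit_poly (rev_digits d) = \poly_(j < k.+1) (int_digit_poly d)`_(k - j).
Proof.
apply/polyP=> j; rewrite !coef_poly ltnS; case: ifP => // le_jk.
rewrite ltnS leq_subr /rev_digits; congr (d _)%:Z; apply/val_inj => /=.
by rewrite !inordK ?subSS // ltnS leq_subr.
Qed.

Lemma horner_int_digit_poly b k (d : 'I_k.+1 -> nat) :
  (int_digit_poly d).[b%:Z] = (digits_value b d)%:Z.
Proof.
rewrite /int_digit_poly poly_def horner_sum -[RHS]natz natr_sum.
by apply: eq_bigr => j _; rewrite hornerZ hornerXn inord_val natrM natrX !natz.
Qed.

Theorem theorem10 (n b k : nat) (d : 'I_k.+1 -> nat)
  (hn : (1 < n)%N) (hnb : (n < b)%N) (hk : (1 <= k)%N)
  (hd : palintiple_1089 n b d) :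
  digit_poly d =
    ((d ord_max)%:R *: 'X^2 - 'X + (d ord0)%:R%:P)
      * (palinomial n d %/ ((n%:R - 1) *: ('X - b%:R%:P)))
  /\
  rev_digit_poly d =
    ((d ord0)%:R *: 'X^2 - 'X + (d ord_max)%:R%:P)
      * (palinomial n d %/ ((n%:R - 1) *: ('X - b%:R%:P))).
Proof.
have [[d_lt dk_neq0 dval] /dvdnP[q bE]] := hd.
set D := int_digit_poly d; set R := int_digit_poly (rev_digits d).
have bZ : b%:Z = (n%:Z + 1) * q%:Z by rewrite bE; lia.
have [C DRC] : exists C, D - n%:Z *: R = C * ('X - (b%:Z)%:P).
  apply/factor_theorem/rootP.
  by rewrite hornerD hornerN hornerZ !horner_int_digit_poly dval PoszM subrr.
have sD : (size D <= k.+1)%N by apply: size_poly.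
have D_digit j : 0 <= D`_j < (n%:Z + 1) * q%:Z.
  by rewrite -bZ coef_poly; case: ifP => _; rewrite ?lez_nat ?ltz_nat ?d_lt; lia.
have D0 : D`_0 = (d ord0)%:Z.
  by rewrite coef_poly /=; congr (d _)%:Z; apply/val_inj; rewrite /= inordK.
have Dk : D`_k = (d ord_max)%:Z.
  by rewrite coef_poly ltnSn; congr (d _)%:Z; apply/val_inj; rewrite /= inordK.
have Dk_neq0 : D`_k != 0 by rewrite Dk; apply/eqP => -[].
have RE : R = \poly_(j < k.+1) D`_(k - j) by apply: int_digit_poly_rev.
have n_gt1 : 1 < n%:Z by lia.
have [] := @digit_poly_1089_int n q k D C n_gt1 sD D_digit Dk_neq0.
  by rewrite -RE -bZ.
rewrite -RE D0 Dk => DE REq.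
have m_neq0 : n%:R - 1 != 0 :> rat by rewrite subr_eq0 pnatr_eq1; lia.
have RQ : map_poly intr R = rev_digit_poly d by apply: map_int_digit_poly.
have DQ : map_poly intr D = digit_poly d by apply: map_int_digit_poly.
have palE : palinomial n d = map_poly intr C * ('X - b%:R%:P).
  have -> : palinomial n d = digit_poly d - n%:R *: rev_digit_poly d.
    rewrite scaler_sumr -sumrB; apply: eq_bigr => j _.
    by rewrite scalerBl scalerA.
  have /(congr1 (map_poly (intr : int -> rat))) := DRC.
  by rewrite rmorphB rmorphM /= map_polyZ map_polyXsubC RQ DQ.
have -> : palinomial n d %/ ((n%:R - 1) *: ('X - b%:R%:P)) =
    (n%:R - 1)^-1 *: map_poly intr C.
  rewrite -[RHS](@mulpK _ _ ((n%:R - 1) *: ('X - b%:R%:P))); last first.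
    by rewrite scaler_eq0 negb_or m_neq0 polyXsubC_eq0.
  by rewrite -scalerAl -scalerAr scalerA mulVf // scale1r palE.
have clear_den (a e : nat) (P : {poly int}) :
    (n%:Z - 1) *: P = (a%:Z *: 'X^2 - 'X + (e%:Z)%:P) * C ->
    map_poly intr P = (a%:R *: 'X^2 - 'X + e%:R%:P)
      * ((n%:R - 1)^-1 *: map_poly intr C) :> {poly rat}.
  move=> /(congr1 (map_poly (intr : int -> rat))).
  rewrite rmorphM rmorphD rmorphB /= !map_polyZ /= map_polyXn map_polyX.
  rewrite map_polyC /= rmorphB /= rmorph1 => PE.
  by rewrite -scalerAr -PE scalerA mulVf // scale1r.
by rewrite -DQ -RQ; split; apply: clear_den.
Qed.
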